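(* Let $G$ be a finite graph, let $A,B \subseteq V(G)$ with $B\subseteq A$, and let $uv$ be an edge of $G$. Then \[ \gamma_g(G|A) \le \gamma_g(G_{uv}|B) \quad \text{and} \quad \gamma_g^\prime(G|A) \le \gamma_g^\prime(G_{uv}|B). \]
   Context: Domination game: on a graph, Dominator and Staller alternately choose vertices; a chosen vertex must dominate (i.e. its closed neighborhood must contain) at least one vertex not dominated by the previously chosen vertices (a legal move). The game ends when no legal move exists. Dominator wants to minimize the total number of moves, Staller to maximize it. For $S\subseteq V(G)$, the partially dominated graph $G|S$ is $G$ with the vertices of $S$ declared already dominated; $\gamma_g(G|S)$ (resp. $\gamma_g^\prime(G|S)$) is the number of moves remaining under optimal play when Dominator (resp. Staller) moves first. For an edge $uv$ of $G$, $G_{uv}$ is the graph obtained from $G-uv$ by adding two new vertices $u',v'$ and the edges $uv'$ and $vu'$, with $u'$ and $v'$ declared dominated; for $B\subseteq V(G)$, $G_{uv}|B$ denotes $G_{uv}$ in which the vertices of $B\cup\{u',v'\}$ are declared dominated. *)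

(* Defs.v *)
From mathcomp Require Import all_boot.

Set Implicit Arguments.
Unset Strict Implicit.
Unset Printing Implicit Defensive.

Lemma bigmin_leq (I : finType) (P : pred I) (F : I -> nat) k x :
  P x -> \big[minn/k]_(i | P i) F i <= F x.
Proof.
move=> Px; have: x \in index_enum I by rewrite mem_index_enum.
elim: (index_enum I) => // y r IHr; rewrite inE big_cons => /predU1P[<-|xr].
  by rewrite Px geq_minl.
by case: ifP => _; rewrite ?geq_min IHr ?orbT.
Qed.

Record sgraph := SGraph {
  vertex :> finType;
  adj : rel vertex;
  adj_sym : symmetric adj;
  adj_irr : irreflexive adj
}.

Section Game.
Variable G : sgraph.
Implicit Types (S : {set G}) (x y : G).

Definition closed_nbhd x : {set G} := [set y | (y == x) || adj x y].

(* [S] is the set of vertices dominated so far, predominated ones included. *)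
Definition legal S x : bool := ~~ (closed_nbhd x \subset S).

Inductive player := Dominator | Staller.

Definition opponent p := if p is Dominator then Staller else Dominator.

(* Minimax value of the position [S] with [p] to move, truncated to [n] moves.
   Each legal move enlarges [S], so [n = #|G|] never truncates; and no position
   lasts more than [#|G|] moves, so [#|G|] is neutral for the minimum. *)
Fixpoint moves_upto (n : nat) (p : player) S : nat :=
  if n is m.+1 then
    if [exists x, legal S x] then
      let after x := moves_upto m (opponent p) (S :|: closed_nbhd x) in
      (match p with
       | Dominator => \big[minn/#|G|]_(x | legal S x) after x
       | Staller => \max_(x | legal S x) after x
       end).+1
    else 0
  else 0.

Definition game_moves p S : nat := moves_upto #|G| p S.

Lemma proper_legal S x : legal S x -> #|~: (S :|: closed_nbhd x)| < #|~: S|.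
Proof.
move=> Lx; apply: proper_card; rewrite properE !setCS subsetUl /=.
by rewrite subUset subxx.
Qed.

Lemma moves_upto_le n p S : moves_upto n p S <= n.
Proof.
elim: n p S => [|n IHn] p S //=; case: ifP => // /existsP[x Lx].
case: p; rewrite ltnS.
  exact: leq_trans (bigmin_leq _ _ Lx) (IHn _ _).
by apply/bigmax_leqP => y _; apply: IHn.
Qed.

Lemma moves_upto_stable n m p S :
  #|~: S| <= n -> #|~: S| <= m -> moves_upto n p S = moves_upto m p S.
Proof.
have no_move T x : #|~: T| <= 0 -> legal T x = false.
  by rewrite leqn0 cards_eq0 => /eqP/setP T0; apply/negbTE; rewrite negbK;
    apply/subsetP => y _; move: (T0 y); rewrite !inE => /negbFE.
have no_ex T : #|~: T| <= 0 -> [exists x, legal T x] = false.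
  by move=> T0; apply/existsP => -[x]; rewrite no_move.
elim: n m p S => [|n IHn] [|m] p S //= Sn Sm.
- by rewrite no_ex.
- by rewrite no_ex.
case: ifP => // _; congr _.+1.
have IH x : legal S x ->
    moves_upto n (opponent p) (S :|: closed_nbhd x)
  = moves_upto m (opponent p) (S :|: closed_nbhd x).
  move=> /proper_legal ltS.
  by apply: IHn; rewrite -ltnS; apply: leq_trans ltS _.
by case: p IH => IH; apply: eq_bigr.
Qed.

Lemma game_moves_over p S : (forall x, ~~ legal S x) -> game_moves p S = 0.
Proof.
move=> noL; rewrite /game_moves; case: #|G| => //= n.
by case: existsP => // -[x]; rewrite (negbTE (noL x)).
Qed.

Lemma game_movesE p S : [exists x, legal S x] ->
  game_moves p S =
    (match p with
     | Dominator => \big[minn/#|G|]_(x | legal S x)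
                      game_moves Staller (S :|: closed_nbhd x)
     | Staller => \max_(x | legal S x)
                      game_moves Dominator (S :|: closed_nbhd x)
     end).+1.
Proof.
move=> exL; rewrite /game_moves.
rewrite (@moves_upto_stable #|G| #|G|.+1) ?max_card ?leqW ?max_card //=.
by rewrite exL; case: p.
Qed.

Lemma game_moves_Dominator_le S x : legal S x ->
  game_moves Dominator S <= (game_moves Staller (S :|: closed_nbhd x)).+1.
Proof.
move=> Lx; rewrite game_movesE; last by apply/existsP; exists x.
by rewrite ltnS (bigmin_leq _ _ Lx).
Qed.

Lemma game_moves_Dominator_opt S : [exists x, legal S x] ->
  exists2 x, legal S x &
    game_moves Dominator S = (game_moves Staller (S :|: closed_nbhd x)).+1.
Proof.
move=> exL; rewrite game_movesE //; have /existsP[x0 L0] := exL.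
set F := fun x => game_moves Staller (S :|: closed_nbhd x).
case: (arg_minnP F L0) => x Lx minx; exists x => //; congr _.+1.
apply/eqP; rewrite eqn_leq; apply/andP; split.
  exact: bigmin_leq.
elim/big_rec: _ => [|y k Ly IH]; first exact: moves_upto_le.
by rewrite leq_min IH minx.
Qed.

Lemma game_moves_Staller_ge S x : legal S x ->
  (game_moves Dominator (S :|: closed_nbhd x)).+1 <= game_moves Staller S.
Proof.
move=> Lx; rewrite (@game_movesE Staller); last by apply/existsP; exists x.
by rewrite ltnS; apply: (leq_bigmax_cond (F := fun x => game_moves _ _)).
Qed.

Lemma game_moves_Staller_opt S : [exists x, legal S x] ->
  exists2 x, legal S x &
    game_moves Staller S = (game_moves Dominator (S :|: closed_nbhd x)).+1.
Proof.
move=> exL; rewrite game_movesE //; have /existsP[x0 L0] := exL.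
have [|x Lx ->] := @eq_bigmax_cond G (legal S)
  (fun x => game_moves Dominator (S :|: closed_nbhd x)).
  by apply/card_gt0P; exists x0.
by exists x.
Qed.

Definition gamma_g S : nat := game_moves Dominator S.
Definition gamma_g' S : nat := game_moves Staller S.

End Game.

Arguments gamma_g : clear implicits.
Arguments gamma_g' : clear implicits.

Section Split.
Variables (G : sgraph) (u v : G).

(* The new vertices [u'] and [v'] are [inr false] and [inr true];
   [u'] is adjacent to [v] only, and [v'] to [u] only. *)
Definition split_u' : G + bool := inr false.
Definition split_v' : G + bool := inr true.

Definition split_adj : rel (G + bool) := fun a b =>
  match a, b with
  | inl x, inl y => adj x y && ((x, y) \notin [:: (u, v); (v, u)])
  | inl x, inr c | inr c, inl x => x == (if c then u else v)
  | inr _, inr _ => false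
  end.

Fact split_adj_sym : symmetric split_adj.
Proof.
move=> [x|c] [y|d] //=; rewrite adj_sym !inE !xpair_eqE.
by rewrite orbC [(x == u) && _]andbC [(x == v) && _]andbC.
Qed.

Fact split_adj_irr : irreflexive split_adj.
Proof. by move=> [x|c] //=; rewrite adj_irr. Qed.

Definition split_graph : sgraph := SGraph split_adj_sym split_adj_irr.

(* The vertices declared dominated in G_uv|B. *)
Definition split_dominated (B : {set G}) : {set split_graph} :=
  [set inl x | x in B] :|: [set split_u'; split_v'].

End Split.

(* Main.v *)
Require Import Defs.
From mathcomp Require Import all_boot.

Set Implicit Arguments.
Unset Strict Implicit.
Unset Printing Implicit Defensive.

(** Dominator plays the game on [G] while imagining the game on the split graph,
    keeping every vertex dominated in the imagined game dominated in the real
    one. A Staller move [x] on [G] that newly dominates [z] is copied to the split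
    graph as [x], unless [xz] is the removed edge, in which case it is copied
    to the new neighbour of [z], one of [u'] and [v']. Dominator's optimal
    imagined moves are copied back, [u'] and [v'] becoming [u] and [v]; if
    the copy is illegal, it would add nothing to the real game, so any legal
    move will do. *)

(** Induction on the number of undominated vertices of [G]: each round costs one move in both games,
    Staller playing optimally on [G] and Dominator on [H]. *)
Lemma game_moves_simulation (G H : sgraph) (R : {set G} -> {set H} -> Prop) :
    (forall A T x, R A T -> legal A x ->
       exists2 y, legal T y & R (A :|: closed_nbhd x) (T :|: closed_nbhd y)) ->
    (forall A T y, R A T -> legal T y -> [exists x, legal A x] ->
       exists2 x, legal A x & R (A :|: closed_nbhd x) (T :|: closed_nbhd y)) ->
  forall p A T, R A T -> game_moves p A <= game_moves p T.
Proof.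
move=> stallerR dominatorR p A.
have [n] := ubnP #|~: A|; elim: n p A => // n IHn p A; rewrite ltnS => leAn T RAT.
have [exA|/existsPn noA] := boolP [exists x, legal A x]; last first.
  by rewrite game_moves_over.
have ltn x : legal A x -> #|~: (A :|: closed_nbhd x)| < n.
  by move=> /proper_legal ltA; apply: leq_trans ltA leAn.
case: p.
(* The imagined game is not over either: the Staller hypothesis turns any legal move on [A] into one
   on [T]. *)
- have /game_moves_Dominator_opt[y Ly ->] : [exists y, legal T y].
    have /existsP[x Lx] := exA; have [y Ly _] := stallerR _ _ _ RAT Lx.
    by apply/existsP; exists y.
  have [x Lx Rxy] := dominatorR _ _ _ RAT Ly exA.
  by apply: leq_trans (game_moves_Dominator_le Lx) _; rewrite ltnS IHn ?ltn.
- have [x Lx ->] := game_moves_Staller_opt exA.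
  have [y Ly Rxy] := stallerR _ _ _ RAT Lx.
  by apply: leq_trans (game_moves_Staller_ge Ly); rewrite ltnS IHn ?ltn.
Qed.

Section SplitStrategy.
Variables (G : sgraph) (u v : G).
Hypothesis uv : adj u v.
Local Notation H := (split_graph u v).
Implicit Types (A : {set G}) (T : {set H}).

Definition old_dominated A T := forall z : G, (inl z : H) \in T -> z \in A.

Definition merge_vertex (y : H) : G :=
  match y with inl x => x | inr c => if c then v else u end.

(** The only old vertex that [u'] dominates is [v], which [u] dominates in [G] through the edge
    [uv]; symmetrically for [v']. *)
Lemma closed_nbhd_merge (y : H) (z : G) :
  (inl z : H) \in closed_nbhd y -> z \in closed_nbhd (merge_vertex y).
Proof.
rewrite !inE; case: y => [x|c] /=.
  by case/predU1P => [[->]|/andP[-> _]]; rewrite ?eqxx ?orbT.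
by move=> /eqP->; case: c; rewrite ?uv 1?adj_sym ?uv orbT.
Qed.

Lemma old_dominated_move A T x y : old_dominated A T ->
    (forall z : G, (inl z : H) \in closed_nbhd y -> z \in A :|: closed_nbhd x) ->
  old_dominated (A :|: closed_nbhd x) (T :|: closed_nbhd y).
Proof. by move=> AT xy z /setUP[/AT zA|/xy //]; rewrite in_setU zA. Qed.

Lemma closed_nbhd_split (x z : G) : z \in closed_nbhd x ->
  exists2 y : H, (inl z : H) \in closed_nbhd y & merge_vertex y = x.
Proof.
move=> xz; have [|nuv] := boolP ((x, z) \in [:: (u, v); (v, u)]).
  rewrite !inE => /orP[/eqP[-> ->]|/eqP[-> ->]].
    by exists (inr false); rewrite // inE /= eqxx.
  by exists (inr true); rewrite // inE /= eqxx.
exists (inl x) => //; move: xz; rewrite !inE /=.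
by case/predU1P => [->|->]; rewrite ?eqxx ?nuv ?orbT.
Qed.

Lemma split_staller A T x : old_dominated A T -> legal A x ->
  exists2 y : H, legal T y &
    old_dominated (A :|: closed_nbhd x) (T :|: closed_nbhd y).
Proof.
move=> AT /subsetPn[z xz zA]; have [y yz yx] := closed_nbhd_split xz.
(* Since [z] is outside [A], the invariant keeps [inl z] outside [T], so [y] is legal. *)
exists y; first by apply/subsetPn; exists (inl z) => //; apply: contra zA => /AT.
apply: old_dominated_move => // w /closed_nbhd_merge.
by rewrite yx in_setU => ->; rewrite orbT.
Qed.

Lemma split_dominator A T (y : H) :
    old_dominated A T -> legal T y -> [exists x, legal A x] ->
  exists2 x, legal A x &
    old_dominated (A :|: closed_nbhd x) (T :|: closed_nbhd y).
Proof.
move=> AT _ /existsP[x0 Lx0].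
have [Lx|/negbNE/subsetP sA] := boolP (legal A (merge_vertex y)).
  exists (merge_vertex y) => //; apply: old_dominated_move => // z.
  by move=> /closed_nbhd_merge yz; rewrite in_setU yz orbT.
exists x0 => //; apply: old_dominated_move => // z.
by move=> /closed_nbhd_merge/sA zA; rewrite in_setU zA.
Qed.

End SplitStrategy.

Theorem theorem3p1 (G : sgraph) (A B : {set G}) (u v : G)
    (sBA : B \subset A) (uv : adj u v) :
  gamma_g G A <= gamma_g (split_graph u v) (split_dominated u v B) /\
  gamma_g' G A <= gamma_g' (split_graph u v) (split_dominated u v B).
Proof.
have sim p : game_moves p A <= game_moves p (split_dominated u v B).
  apply: (@game_moves_simulation _ _ (@old_dominated G u v)).
  - exact: split_staller.
  - exact: split_dominator.
  (* Initially the dominated old vertices are exactly those of [B]. *)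
  - move=> z; rewrite !inE !orbF => /imsetP[x xB [->]].
    exact: (subsetP sBA).
by split; apply: sim.
Qed.
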